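(* For every $n\geq 1$, $f_n(321)=f_n(312)$; that is, the patterns $321$ and $312$ are forest-Wilf-equivalent.
   Context: A forest on $[n]$ is an unordered rooted forest whose $n$ vertices are labeled bijectively by $[n]$. A forest avoids a pattern $\sigma\in\mathfrak{S}_k$ if for every vertex $v$, the sequence of labels along the path from the root of the tree containing $v$ down to $v$ contains no subsequence in the same relative order as $\sigma$. $f_n(\sigma)$ is the number of forests on $[n]$ avoiding $\sigma$. Two patterns $\sigma,\tau$ are forest-Wilf-equivalent if $f_n(\sigma)=f_n(\tau)$ for all $n$. *)

(* Defs.v *)
From mathcomp Require Import all_boot all_fingroup.

Set Implicit Arguments.
Unset Strict Implicit.
Unset Printing Implicit Defensive.

(* A set of parent links on the vertex set 'I_n: [p v = Some w] when w is the
   parent of v, and [p v = None] when v is a root.  Labels are shifted down by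
   one, {0, ..., n-1} instead of {1, ..., n}; only their relative order counts. *)
Definition parent_map (n : nat) := {ffun 'I_n -> option 'I_n}.

Section Forests.
Variable n : nat.
Implicit Types (p : parent_map n) (v : 'I_n).

(* The k-th ancestor of v, or None above the root. *)
Definition ancestor p v (k : nat) : option 'I_n := iter k (obind p) (Some v).

(* No cycles: n steps suffice since a path to the root has at most n vertices;
   see [is_forestP]. *)
Definition is_forest p : bool := [forall v, ancestor p v n == None].

(* The labels met on the way from the root down to v, both included. *)
Definition root_path p v : seq 'I_n :=
  rev (pmap (ancestor p v) (iota 0 n)).

End Forests.

Definition order_isomorphic (n k : nat) (t : k.-tuple 'I_n) (s : 'S_k) : bool :=
  [forall i, forall j, (tnth t i < tnth t j) == (s i < s j)].

Definition contains_pattern (n k : nat) (w : seq 'I_n) (s : 'S_k) : bool :=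
  [exists t : k.-tuple 'I_n, subseq t w && order_isomorphic t s].

Definition avoids (n k : nat) (p : parent_map n) (s : 'S_k) : bool :=
  [forall v, ~~ contains_pattern (root_path p v) s].

Definition num_avoiding_forests (n k : nat) (s : 'S_k) : nat :=
  #|[set p : parent_map n | is_forest p && avoids p s]|.

Definition forest_Wilf_equivalent (k l : nat) (s : 'S_k) (t : 'S_l) : Prop :=
  forall n : nat, num_avoiding_forests n s = num_avoiding_forests n t.

Definition one_line (k : nat) (s : 'S_k) : seq nat :=
  [seq (s i).+1 | i <- enum 'I_k].

Definition pattern321 : 'S_3 := perm (@rev_ord_inj 3).
Definition pattern312 : 'S_3 := perm (can_inj (@ord_predK 3)).

Lemma one_line_pattern321 : one_line pattern321 = [:: 3; 2; 1].
Proof. by rewrite /one_line !enum_ordSl enum_ord0 /= !permE. Qed.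

Lemma one_line_pattern312 : one_line pattern312 = [:: 3; 1; 2].
Proof. by rewrite /one_line !enum_ordSl enum_ord0 /= !permE. Qed.

Lemma is_forestP (n : nat) (p : parent_map n) :
  reflect (forall v, exists k, ancestor p v k = None) (is_forest p).
Proof.
apply: (iffP forallP) => [h v|h v]; first by exists n; apply/eqP.
have absorb j k : j <= k -> ancestor p v j = None -> ancestor p v k = None.
  move=> /subnK <- e; rewrite /ancestor iterD -/(ancestor p v j) e.
  by elim: (k - j) => //= m ->.
case E: (ancestor p v n) => [w|//]; exfalso.
have live (i : 'I_n.+1) : ancestor p v i != None.
  by apply/eqP => /(absorb i n (leq_ord i)); rewrite E.
pose f (i : 'I_n.+1) := odflt w (ancestor p v i).
have fE (i : 'I_n.+1) : ancestor p v i = Some (f i).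
  by have := live i; rewrite /f; case: (ancestor p v i).
have /injectivePn[i [j nij fij]] : ~~ injectiveb f.
  by apply/injectiveP => /leq_card; rewrite !card_ord ltnn.
wlog lt_ij : i j nij fij / i < j.
  move=> H; case: (ltngtP i j) => [lt|lt|/val_inj e]; last by rewrite e eqxx in nij.
  - exact: (H i j).
  - by apply: (H j i); rewrite 1?eq_sym.
have per m : ancestor p v (m * (j - i) + i) = Some (f i).
  elim: m => [|m IH]; first exact: fE.
  rewrite mulSn -addnA /ancestor iterD -/(ancestor p v _) IH -(fE i).
  by rewrite -iterD subnK ?(ltnW lt_ij) // -/(ancestor p v j) fE -fij.
case: (h v) => k /(absorb k (k * (j - i) + i)); rewrite per => H.
suff : Some (f i) = None by [].
by apply: H; apply: leq_trans (leq_addr _ _); rewrite leq_pmulr // subn_gt0.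
Qed.

(* [root_path p v] is the path of a forest p from a root down to v. *)
Lemma root_pathP (n : nat) (p : parent_map n) (v : 'I_n) : is_forest p ->
  exists r w, [/\ root_path p v = r :: w, p r = None,
                  path (fun x y => p y == Some x) r w & last r w = v].
Proof.
move=> /forallP/(_ v)/eqP vn.
have gN k m : pmap (fun i => iter i (obind p) None) (iota m k) = [::] :> seq 'I_n.
  elim: k m => //= k IH m; have -> : iter m (obind p) None = None :> option 'I_n.
    by elim: m => //= m ->.
  exact: IH.
have shift k m (o : option 'I_n) :
    pmap (fun i => iter i (obind p) o) (iota m.+1 k)
    = pmap (fun i => iter i (obind p) (obind p o)) (iota m k).
  by elim: k m => //= k IH m; rewrite IH -iterSr.
have ups k x : ancestor p x k = None -> exists r w,
    [/\ rev (pmap (ancestor p x) (iota 0 k)) = r :: w, p r = None,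
        path (fun x y => p y == Some x) r w & last r w = x].
  elim: k x => //= k IH x; rewrite /ancestor -iterS iterSr /= shift /=.
  case Ex: (p x) => [y|]; last first.
    by move=> _; exists x, [::]; rewrite gN Ex.
  move=> /IH[r [w [E pr pw lw]]]; exists r, (rcons w x).
  by rewrite rev_cons E rcons_path last_rcons pw lw Ex eqxx; split.
exact: ups.
Qed.

(* Main.v *)
Require Import Defs.
From mathcomp Require Import all_boot all_fingroup.

(** Counting pairs (forest, relabeling) in two ways reduces the theorem to one
    fixed forest: among the labelings of its vertices, as many avoid 321 as 312.
    Avoiding 321 means that no vertex is the middle of a 321, avoiding 312 that no
    vertex is the end with the smallest label (the "1") of a 312.  The first
    condition is traded for the second one vertex at a time, descendants first.
    At a vertex r whose label is below M, the largest label above r, let S be the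
    set of the labels less than M carried by r or its descendants.  The first
    condition at r says that the label of r is min S, the second that it is max S,
    and the cyclic shift of S (min S to max S, every other element to its
    predecessor) turns one into the other without affecting the condition imposed
    at any other vertex. *)

Set Implicit Arguments.
Unset Strict Implicit.
Unset Printing Implicit Defensive.

(** * The cyclic shift of a set of labels *)

Section Cycle.
Variables (n : nat) (S : {set 'I_n}).

(** [enum S] is increasing and [prev] walks back along it cyclically, fixing every point outside
    [S]. *)
Definition shift_down : {perm 'I_n} :=
  perm (can_inj (next_prev (enum_uniq (mem S)))).

Lemma shift_down_in x : (shift_down x \in S) = (x \in S).
Proof. by rewrite permE -mem_enum mem_prev mem_enum. Qed.

Lemma shift_down_out x : x \notin S -> shift_down x = x.
Proof. by rewrite permE prev_nth mem_enum => /negbTE->. Qed.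

Lemma sorted_enum_set : sorted ltn (map val (enum S)).
Proof.
rewrite {1}/enum_mem -enumT; apply: (subseq_sorted ltn_trans (map_subseq _ (filter_subseq _ _))).
by rewrite val_enum_ord iota_ltn_sorted.
Qed.

Lemma shift_down_spec m : m \in S -> {in S, forall x : 'I_n, m <= x} ->
  {in S, forall x : 'I_n, x <= shift_down m} /\
  {in [predD1 S & m] &, forall x y, (shift_down x < shift_down y) = (x < y)}.
Proof.
move=> mS mmin.
have eS x : (x \in S) = (x \in enum S) by rewrite mem_enum.
have:= sorted_enum_set; rewrite sorted_map; have := enum_uniq (mem S).
case E: (enum S) => [|a e]; first by rewrite eS E in mS.
move=> /= /andP[aNe ue] srt.
have nthlt i j : i < size (a :: e) -> j < size (a :: e) ->
    (nth a (a :: e) i < nth a (a :: e) j) = (i < j).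
  have tr : transitive (fun x y : 'I_n => x < y) by move=> ? ? ?; apply: ltn_trans.
  have mono k l : k < l -> l < size (a :: e) -> nth a (a :: e) k < nth a (a :: e) l.
    by move=> kl ll; apply: (sorted_ltn_nth tr) => //; rewrite inE (ltn_trans kl).
  move=> li lj; case: (ltngtP i j) => [ij|ji|->]; [exact: mono| |exact: ltnn].
  by apply/negbTE; rewrite -leqNgt ltnW // mono.
have am : a = m.
  have aS : a \in S by rewrite eS E mem_head.
  apply/val_inj/eqP; rewrite eqn_leq mmin // andbT leqNgt.
  have := mS; rewrite eS E => /(nthP a)[i li <-].
  by rewrite -[X in _ < X]/(val (nth a (a :: e) 0)) nthlt.
(* Looking [x] up in the tail [e] lowers its position by one; the head [a], absent from [e], gets
   index [size e], hence the last entry. *)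
have pE x : x \in S -> shift_down x = nth a (a :: e) (index x e).
  by move=> xS; rewrite permE prev_nth mem_enum xS E.
split=> [x xS|x y].
  rewrite pE // -am (memNindex aNe) leqNgt.
  have := xS; rewrite eS E => /(nthP a)[i li <-].
  by rewrite nthlt //= -leqNgt -ltnS.
rewrite !inE -am => /andP[xa xS] /andP[ya yS]; rewrite !pE //.
have xe : x \in e by have := xS; rewrite eS E inE (negbTE xa).
have ye : y \in e by have := yS; rewrite eS E inE (negbTE ya).
rewrite nthlt ?ltnS ?index_size //.
rewrite -{2}(nth_index a xe) -{2}(nth_index a ye).
rewrite -[RHS]/(nth a (a :: e) (index x e).+1 < nth a (a :: e) (index y e).+1).
by rewrite nthlt //= ltnS index_mem.
Qed.

Lemma shift_down_inv_spec m : m \in S -> {in S, forall x : 'I_n, x <= m} ->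
  {in S, forall x : 'I_n, (shift_down^-1)%g m <= x} /\
  {in [predD1 S & m] &, forall x y,
     ((shift_down^-1)%g x < (shift_down^-1)%g y) = (x < y)}.
Proof.
move=> mS mmax; set c := (shift_down^-1)%g.
case: (arg_minnP val mS) => a aS amin; have [h1 h2] := shift_down_spec aS amin.
have am : shift_down a = m.
  by apply/val_inj/eqP; rewrite eqn_leq mmax ?shift_down_in //= h1.
have ca : c m = a by rewrite /c -am permK.
split=> [|x y /andP[xm xS] /andP[ym yS]]; first by rewrite ca.
rewrite -{2}(permKV shift_down x) -{2}(permKV shift_down y) h2 // !inE.
  by rewrite -shift_down_in permKV xS -ca (inj_eq perm_inj) xm.
by rewrite -shift_down_in permKV yS -ca (inj_eq perm_inj) ym.
Qed.

End Cycle.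

(** * Labelings of a fixed forest *)

Section Labelings.
Variables (n : nat) (lt : rel 'I_n).
(* [lt w v] stands for: w is a proper ancestor of v. *)
Hypotheses (lt_irr : irreflexive lt) (lt_trans : transitive lt).
Hypothesis lt_chain : forall u w v, lt u v -> lt w v -> [|| u == w, lt u w | lt w u].
Implicit Types (s c : {perm 'I_n}) (r u v w x y : 'I_n) (D : {set 'I_n}).

Definition mid321_free s u :=
  [forall w, forall v, lt w u && lt u v ==> ~~ (s v < s u < s w)].

Definition low312_free s u :=
  [forall w, forall v, lt w u && lt u v ==> ~~ (s u < s v < s w)].

(** Interpolates between the two avoidance conditions: 321 for [set0], 312 for [setT]. *)
Definition hybrid D : {set {perm 'I_n}} :=
  [set s | [forall u, if u \in D then low312_free s u else mid321_free s u]].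

Lemma mid321_freeP s u :
  reflect (forall w v, lt w u -> lt u v -> s v < s u -> s u < s w -> False)
          (mid321_free s u).
Proof.
apply: (iffP forallP) => [h w v wu uv a b|h w].
  by have /forallP/(_ v) := h w; rewrite wu uv a b.
by apply/forallP=> v; apply/implyP=> /andP[wu uv]; apply/negP => /andP[a b]; apply: h a b.
Qed.

Lemma low312_freeP s u :
  reflect (forall w v, lt w u -> lt u v -> s u < s v -> s v < s w -> False)
          (low312_free s u).
Proof.
apply: (iffP forallP) => [h w v wu uv a b|h w].
  by have /forallP/(_ v) := h w; rewrite wu uv a b.
by apply/forallP=> v; apply/implyP=> /andP[wu uv]; apply/negP => /andP[a b]; apply: h a b.
Qed.

Definition subtree r v := (v == r) || lt r v.

(** This is [x < M] without naming M, so that it also makes sense at a root, where nothing is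
    capped. *)
Definition capped s r x := [exists w, lt w r && (x < s w)].

(* The set S of the header; empty when the label of r exceeds those of all its
   ancestors, in which case both conditions hold vacuously at r. *)
Definition movable s r : {set 'I_n} :=
  [set x | [&& capped s r (s r), capped s r x & subtree r ((s^-1)%g x)]].

Lemma in_movable s r v :
  (s v \in movable s r) = [&& capped s r (s r), capped s r (s v) & subtree r v].
Proof. by rewrite inE permK. Qed.

Lemma subtree_down r u v : subtree r u -> lt u v -> lt r v.
Proof. by case/orP => [/eqP->|/lt_trans h] //; apply: h. Qed.

Lemma lt_notin_subtree w r : lt w r -> ~~ subtree r w.
Proof.
move=> wr; apply/negP => /orP[/eqP e|rw]; first by rewrite e lt_irr in wr.
by have := lt_trans wr rw; rewrite lt_irr.
Qed.

(** A smaller movable label sits at a descendant of [r]; with an ancestor whose label exceeds that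
    of [r], it would complete a 321 centred at [r]. *)
Lemma mid321_free_min s r x :
  mid321_free s r -> x \in movable s r -> s r <= x.
Proof.
move/mid321_freeP => h; rewrite -(permKV s x); set v := _ x.
rewrite in_movable => /and3P[/existsP[w /andP[wr rw]] _ /orP[/eqP->//|rv]].
by rewrite leqNgt; apply/negP => vr; apply: (h w v).
Qed.

Lemma low312_free_max s r x :
  low312_free s r -> x \in movable s r -> x <= s r.
Proof.
move/low312_freeP => h; rewrite -(permKV s x); set v := _ x.
rewrite in_movable => /and3P[_ /existsP[w /andP[wr rw]] /orP[/eqP->//|rv]].
by rewrite leqNgt; apply/negP => vr; apply: (h w v).
Qed.

Lemma min_mid321_free s r :
  {in movable s r, forall x, s r <= x} -> mid321_free s r.
Proof.
move=> h; apply/mid321_freeP => w v wr rv vr rw.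
have: s r <= s v; last by rewrite leqNgt vr.
apply: h; rewrite in_movable /subtree rv orbT andbT.
by apply/andP; split; apply/existsP; exists w; rewrite wr //= (ltn_trans vr).
Qed.

Lemma max_low312_free s r :
  {in movable s r, forall x, x <= s r} -> low312_free s r.
Proof.
move=> h; apply/low312_freeP => w v wr rv vr rw.
have: s v <= s r; last by rewrite leqNgt vr.
apply: h; rewrite in_movable /subtree rv orbT andbT.
by apply/andP; split; apply/existsP; exists w; rewrite wr //= (ltn_trans vr).
Qed.

(** * Permuting the movable labels at one vertex *)

Section Relabel.
Variables (s : {perm 'I_n}) (r : 'I_n) (c : {perm 'I_n}).
Hypothesis c_in : forall x, (c x \in movable s r) = (x \in movable s r).
Hypothesis c_out : forall x, x \notin movable s r -> c x = x.

Lemma relabel_out v : ~~ subtree r v -> c (s v) = s v.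
Proof. by move=> h; apply: c_out; rewrite in_movable (negbTE h) !andbF. Qed.

Lemma relabel_capped x : capped (s * c)%g r x = capped s r x.
Proof.
apply: eq_existsb => w; case wr: (lt w r) => //=.
by rewrite permM relabel_out // lt_notin_subtree.
Qed.

Lemma relabel_subtree v : subtree r ((s^-1)%g (c v)) = subtree r ((s^-1)%g v).
Proof.
have [vS|/c_out->//] := boolP (v \in movable s r).
have := vS; rewrite -c_in !inE => /and3P[_ _ ->].
by move: vS; rewrite inE => /and3P[].
Qed.

Lemma capped_root : capped s r (c (s r)) = capped s r (s r).
Proof.
have [rS|/c_out->//] := boolP (s r \in movable s r).
have := rS; rewrite -c_in !inE => /and3P[_ -> _].
by move: rS; rewrite inE => /and3P[].
Qed.

(** The ancestors of [r] keep their labels, so M is unchanged, and [c] permutes S within itself.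
    This makes [raise] and [lower] mutually inverse. *)
Lemma movable_relabel : movable (s * c)%g r = movable s r.
Proof.
apply/setP => x; rewrite !inE !relabel_capped permM capped_root invMg permM.
by rewrite -(relabel_subtree ((c^-1)%g x)) permKV.
Qed.

(** Labels at and above [u] are fixed, and labels that move stay below [u], so a 321 centred at [u]
    afterwards yields one that was there before. *)
Lemma relabel_mid321_free u :
  ~~ subtree r u -> mid321_free s u -> mid321_free (s * c)%g u.
Proof.
move=> ru /mid321_freeP h; apply/mid321_freeP => w v wu uv.
have rw : ~~ subtree r w.
  by apply: contra ru => /subtree_down/(_ wu) h'; rewrite /subtree h' orbT.
rewrite !permM !(relabel_out ru) !(relabel_out rw).
(* [v'] is the vertex that carried the new label of [v] before the relabeling. *)
rewrite -(permKV s (c (s v))); set v' := _ (c _) => a b.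
apply: (h w v') => //.
have [vS|/c_out e] := boolP (s v \in movable s r); last by rewrite /v' e permK.
have rv : subtree r v by move: vS; rewrite in_movable => /and3P[].
have ur : lt u r.
  case/orP: rv uv => [/eqP->//|rv] uv.
  by case/or3P: (lt_chain uv rv) ru => // [/eqP e|h']; rewrite /subtree ?e ?eqxx ?h' ?orbT.
have: subtree r v' by rewrite /v' relabel_subtree permK.
by case/orP=> [/eqP->//|]; apply: lt_trans.
Qed.

(** Here [u] is incomparable with [r], so no vertex above or below [u] lies in the subtree of
    [r]. *)
Lemma relabel_low312_free_out u :
  ~~ subtree r u -> ~~ lt u r -> low312_free s u -> low312_free (s * c)%g u.
Proof.
move=> ru ur /low312_freeP h; apply/low312_freeP => w v wu uv.
have rw : ~~ subtree r w.
  by apply: contra ru => /subtree_down/(_ wu) h'; rewrite /subtree h' orbT.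
have rv : ~~ subtree r v.
  apply/negP => /orP[/eqP e|rv]; first by rewrite -e uv in ur.
  move: ru ur; rewrite /subtree.
  by case/or3P: (lt_chain uv rv) => ->; rewrite ?orbT.
rewrite !permM !relabel_out //; exact: h.
Qed.

(** When S is nonempty, the labels of proper descendants of [r] that are less than M are exactly the
    movable ones: they keep their relative order and stay below M, while the others are fixed. Only
    a 3 located at [r] or above needs another argument. *)
Lemma relabel_low312_free_in u :
  {in [predD1 movable s r & s r] &, forall x y, (c x < c y) = (x < y)} ->
  lt r u -> low312_free s u -> low312_free (s * c)%g u.
Proof.
move=> mono ru /low312_freeP h; apply/low312_freeP => w v wu uv.
have rv := lt_trans ru uv; rewrite !permM.
have [cr|ncr] := boolP (capped s r (s r)); last first.
  by rewrite !c_out ?in_movable ?(negbTE ncr) //; apply: h.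
have mv x : subtree r x -> (s x \in movable s r) = capped s r (s x).
  by move=> rx; rewrite in_movable cr rx andbT.
have ne x : lt r x -> s x != s r.
  by move=> rx; rewrite (inj_eq perm_inj); apply: contraTneq rx => ->; rewrite lt_irr.
have st x : lt r x -> subtree r x by rewrite /subtree orbC => ->.
have cmv x : subtree r x -> capped s r (c (s x)) -> s x \in movable s r.
  move=> rx cx; rewrite -c_in inE cr cx relabel_subtree permK; exact: rx.
have up x y : x < y -> capped s r y -> capped s r x.
  move=> xy /existsP[z /andP[zr yz]]; apply/existsP; exists z.
  by rewrite zr (ltn_trans xy).
have [rw|rw] := boolP (lt r w).
  have cmono x y : lt r x -> lt r y -> c (s x) < c (s y) -> s x < s y.
    move=> rx ry; have [yS|yS] := boolP (s y \in movable s r).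
      move=> xy; have xS : s x \in movable s r.
        apply: cmv (st _ rx) (up _ _ xy _).
        by move: yS; rewrite -c_in inE => /and3P[].
      by rewrite -mono // inE /= ne.
    rewrite (c_out yS).
    have [xS _|xS] := boolP (s x \in movable s r); last by rewrite c_out.
    rewrite ltnNge; apply: contra yS; rewrite leq_eqVlt => /orP[/eqP/val_inj->//|yx].
    by rewrite mv ?st //; apply: up yx _; rewrite -mv ?st.
  move=> a b; apply: (h w v wu uv); exact: cmono.
(* Now [w] is [r] or an ancestor of it. The new labels of [u] and [v] are then less than M, so both
   old labels are movable, and some ancestor [w'] of [r] can replace [w] as the 3. *)
move=> a b.
have cv : capped s r (c (s v)).
  have: lt w r || (w == r).
    by case/or3P: (lt_chain ru wu) rw => [/eqP->|->|->]; rewrite ?eqxx ?orbT.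
  case/orP=> [wr|/eqP e].
    by apply/existsP; exists w; rewrite wr -(relabel_out (lt_notin_subtree wr)).
  by apply: (up _ _ b); rewrite e capped_root.
have vS := cmv _ (st _ rv) cv.
have uS := cmv _ (st _ ru) (up _ _ a cv).
have := vS; rewrite mv ?st // => /existsP[w' /andP[wr vw]].
apply: (h w' v (lt_trans wr ru) uv _ vw).
by rewrite -mono // inE /= ne.
Qed.

End Relabel.

(** Products of permutations act left to right: the shift is applied to labels, after [s]. *)
Definition raise s r := (s * shift_down (movable s r))%g.
Definition lower s r := (s * (shift_down (movable s r))^-1)%g.

Lemma shift_down_inv_in (S : {set 'I_n}) x : ((shift_down S)^-1%g x \in S) = (x \in S).
Proof. by rewrite -shift_down_in permKV. Qed.

Lemma shift_down_inv_out (S : {set 'I_n}) x : x \notin S -> (shift_down S)^-1%g x = x.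
Proof. by move=> xS; apply: (@perm_inj _ (shift_down S)); rewrite permKV shift_down_out. Qed.

Lemma movable_raise s r : movable (raise s r) r = movable s r.
Proof. exact: movable_relabel (shift_down_in _) (@shift_down_out _ _). Qed.

Lemma movable_lower s r : movable (lower s r) r = movable s r.
Proof. exact: movable_relabel (@shift_down_inv_in _) (@shift_down_inv_out _). Qed.

Lemma raiseK r : cancel (raise^~ r) (lower^~ r).
Proof. by move=> s; rewrite /lower movable_raise mulgK. Qed.

Lemma lowerK r : cancel (lower^~ r) (raise^~ r).
Proof. by move=> s; rewrite /raise movable_lower mulgKV. Qed.

Lemma movable_root s r : movable s r != set0 -> s r \in movable s r.
Proof.
case/set0Pn=> x; rewrite in_movable inE => /and3P[h _ _].
by rewrite h /subtree eqxx.
Qed.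

(** The hypothesis makes the label of [r] the minimum of S, which the shift sends to the maximum.
    The second conjunct is what [relabel_low312_free_in] requires. *)
Lemma raise_root s r : mid321_free s r ->
  low312_free (raise s r) r /\
  {in [predD1 movable s r & s r] &,
    forall x y, (shift_down (movable s r) x < shift_down (movable s r) y) = (x < y)}.
Proof.
move=> h; have [S0|/movable_root rS] := eqVneq (movable s r) set0.
  split; last by move=> x y /andP[_]; rewrite [_ \in _]/= S0 inE.
  by apply: max_low312_free => x; rewrite movable_raise S0 inE.
have [h1 h2] := shift_down_spec rS (fun x => @mid321_free_min s r x h).
split=> //; apply: max_low312_free => x; rewrite movable_raise permM; exact: h1.
Qed.

Lemma lower_root s r : low312_free s r ->
  mid321_free (lower s r) r /\
  {in [predD1 movable s r & s r] &, forall x y,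
    ((shift_down (movable s r))^-1%g x < (shift_down (movable s r))^-1%g y) = (x < y)}.
Proof.
move=> h; have [S0|/movable_root rS] := eqVneq (movable s r) set0.
  split; last by move=> x y /andP[_]; rewrite [_ \in _]/= S0 inE.
  by apply: min_mid321_free => x; rewrite movable_lower S0 inE.
have [h1 h2] := shift_down_inv_spec rS (fun x => @low312_free_max s r x h).
split=> //; apply: min_mid321_free => x; rewrite movable_lower permM; exact: h1.
Qed.

(** * Trading the condition at one vertex *)

Section Step.
Variables (D : {set 'I_n}) (r : 'I_n).
Hypotheses (rD : r \notin D) (D_below : forall v, lt r v -> v \in D).
Hypothesis D_down : forall u v, u \in D -> lt u v -> v \in D.

(** Since [D] is closed under descendants and omits [r], its vertices are below [r] or incomparable
    with it; vertices outside [r |: D] are not below [r]. One relabeling lemma covers each case. *)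
Lemma raise_hybrid s : s \in hybrid D -> raise s r \in hybrid (r |: D).
Proof.
rewrite !inE => /forallP h; apply/forallP=> u; rewrite !inE.
have := h r; rewrite (negbTE rD) => /raise_root[hr mono].
have [->//|ur] /= := eqVneq u r.
have ci := shift_down_in (movable s r); have co := @shift_down_out _ (movable s r).
have := h u; case: ifP => uD.
  have [ru|ru] := boolP (lt r u); first exact: (relabel_low312_free_in ci co).
  apply: (relabel_low312_free_out co) => //; first by rewrite /subtree negb_or ur.
  by apply: contra rD => /(D_down uD).
apply: (relabel_mid321_free ci co) => //.
by rewrite /subtree negb_or ur; apply: contraFN uD => /D_below.
Qed.

Lemma lower_hybrid s : s \in hybrid (r |: D) -> lower s r \in hybrid D.
Proof.
rewrite !inE => /forallP h; apply/forallP=> u.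
have := h r; rewrite setU11 => /lower_root[hr mono].
have [->|ur] /= := eqVneq u r; first by rewrite (negbTE rD).
have ci := @shift_down_inv_in (movable s r).
have co := @shift_down_inv_out (movable s r).
have := h u; rewrite !inE (negbTE ur) /=; case: ifP => uD.
  have [ru|ru] := boolP (lt r u); first exact: (relabel_low312_free_in ci co).
  apply: (relabel_low312_free_out co) => //; first by rewrite /subtree negb_or ur.
  by apply: contra rD => /(D_down uD).
apply: (relabel_mid321_free ci co) => //.
by rewrite /subtree negb_or ur; apply: contraFN uD => /D_below.
Qed.

Lemma card_hybrid_step : #|hybrid (r |: D)| = #|hybrid D|.
Proof.
apply/eqP; rewrite eqn_leq; apply/andP; split.
  rewrite -(card_imset _ (can_inj (lowerK r))); apply/subset_leq_card/subsetP.
  by move=> _ /imsetP[s hs ->]; apply: lower_hybrid.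
rewrite -(card_imset _ (can_inj (raiseK r))); apply/subset_leq_card/subsetP.
by move=> _ /imsetP[s hs ->]; apply: raise_hybrid.
Qed.

End Step.

Lemma card_hybrid D :
  (forall u v, u \in D -> lt u v -> v \in D) -> #|hybrid D| = #|hybrid set0|.
Proof.
elim: {D}_.+1 {-2}D (ltnSn #|D|) => // m IH D; rewrite ltnS => Dm Ddown.
have [->//|/set0Pn[r0 r0D]] := eqVneq D set0.
(* A vertex of [D] with the most descendants has no ancestor in [D], which would have strictly more.
   Hence [D :\ r] is still closed under descendants. *)
case: (arg_maxnP (fun u => #|[set v | lt u v]|) r0D) => r rD0 rmax; have {rD0} rD : r \in D := rD0.
have notbelow u : u \in D -> ~~ lt u r.
  move=> uD; apply/negP => ur; have := rmax u uD; apply/negP; rewrite -ltnNge.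
  apply: proper_card; apply/properP; split.
    by apply/subsetP => v; rewrite !inE; apply: lt_trans.
  by exists r; rewrite inE ?lt_irr.
have down u v : u \in D :\ r -> lt u v -> v \in D :\ r.
  rewrite !inE => /andP[_ uD] uv; rewrite (Ddown u) // andbT.
  by apply: contraTneq uv => ->; apply: notbelow.
rewrite -(setD1K rD) card_hybrid_step //.
- by apply: IH down; rewrite (cardsD1 r) rD in Dm.
- by rewrite !inE eqxx.
by move=> v rv; rewrite !inE (Ddown r) // andbT; apply: contraTneq rv => ->; rewrite lt_irr.
Qed.

Lemma card_labelings :
  #|[set s | [forall u, mid321_free s u]]| = #|[set s | [forall u, low312_free s u]]|.
Proof.
have := @card_hybrid setT (fun _ _ _ _ => in_setT _) => e.
transitivity #|hybrid set0|; last rewrite -e; apply: eq_card => s; rewrite !inE;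
  by apply: eq_forallb => u; rewrite ?in_set0 ?in_setT.
Qed.

End Labelings.

(** * Ancestry in a forest *)

Section Ancestry.
Variable n : nat.
Implicit Types (p : parent_map n) (s : {perm 'I_n}) (u v w : 'I_n).

(** The bound on [k] keeps the relation boolean and loses nothing in a forest. *)
Definition proper_ancestor p w v := [exists k : 'I_n, ancestor p v k.+1 == Some w].

Lemma ancestorD p v w j k :
  ancestor p v k = Some w -> ancestor p v (j + k) = ancestor p w j.
Proof. by rewrite /ancestor iterD => ->. Qed.

Lemma ancestor_overflow p v k : is_forest p -> n <= k -> ancestor p v k = None.
Proof.
move=> /forallP/(_ v)/eqP e /subnK <-; rewrite /ancestor iterD -/(ancestor p v n) e.
by elim: (k - n) => //= m ->.
Qed.

Lemma proper_ancestorP p w v : is_forest p ->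
  reflect (exists k, ancestor p v k.+1 = Some w) (proper_ancestor p w v).
Proof.
move=> pF; apply: (iffP existsP) => [[k /eqP e]|[k e]]; first by exists k.
have [nk|kn] := leqP n k; first by rewrite ancestor_overflow // leqW in e.
by exists (Ordinal kn); apply/eqP.
Qed.

Lemma proper_ancestor_irr p : is_forest p -> irreflexive (proper_ancestor p).
Proof.
move=> pF v; apply/negbTE/negP => /existsP[k /eqP e].
(* A vertex above itself would recur forever, beyond the [n] steps that lead out of a forest. *)
have E m : ancestor p v (m * k.+1) = Some v.
  by elim: m => // m IH; rewrite mulSn (ancestorD _ IH).
by have := E n; rewrite ancestor_overflow // leq_pmulr.
Qed.

Lemma proper_ancestor_trans p : is_forest p -> transitive (proper_ancestor p).
Proof.
move=> pF v u w /(proper_ancestorP _ _ pF)[j ej] /(proper_ancestorP _ _ pF)[k ek].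
by apply/(proper_ancestorP _ _ pF); exists (j + k.+1); rewrite -addSn (ancestorD _ ek).
Qed.

Lemma proper_ancestor_chain p u w v : is_forest p ->
  proper_ancestor p u v -> proper_ancestor p w v ->
  [|| u == w, proper_ancestor p u w | proper_ancestor p w u].
Proof.
move=> pF /(proper_ancestorP _ _ pF)[j ej] /(proper_ancestorP _ _ pF)[k ek].
case: (ltngtP j k) => [jk|kj|jk]; last first.
- by move: ej; rewrite jk ek => -[->]; rewrite eqxx.
- apply/or3P/Or32/(proper_ancestorP _ _ pF); exists (j - k.+1).
  by rewrite -(ancestorD _ ek) -ej -subSn // subnK // ltnW.
apply/or3P/Or33/(proper_ancestorP _ _ pF); exists (k - j.+1).
by rewrite -(ancestorD _ ej) -ek -subSn // subnK // ltnW.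
Qed.

(** * Root paths as chains of ancestors *)

Lemma subseq_root_path p a b c v : is_forest p ->
  subseq [:: a; b; c] (root_path p v) -> proper_ancestor p a b /\ proper_ancestor p b c.
Proof.
move=> pF; have [r [w [-> _ pw _]]] := root_pathP v pF.
have srt : sorted (proper_ancestor p) (r :: w).
  apply: sub_path pw => x y /eqP e.
  by apply/(proper_ancestorP _ _ pF); exists 0; rewrite -e.
move=> /subseq_sorted-/(_ _ (proper_ancestor_trans pF) srt).
by rewrite /= andbT => /andP[].
Qed.

Lemma root_path_subseq p a b c : is_forest p ->
  proper_ancestor p a b -> proper_ancestor p b c ->
  subseq [:: a; b; c] (root_path p c).
Proof.
move=> pF /(proper_ancestorP _ _ pF)[j ej] /(proper_ancestorP _ _ pF)[k ek].
have e : ancestor p c (j.+1 + k.+1) = Some a by rewrite (ancestorD _ ek).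
have lt_n : j.+1 + k.+1 < n.
  by rewrite ltnNge; apply/negP => /(ancestor_overflow c pF); rewrite e.
rewrite /root_path -[X in subseq X]revK subseq_rev.
(* Cut at the distances from [c] to [b] and to [a]: each of the three blocks begins with the index
   of one of [c], [b], [a]. *)
have -> : iota 0 n =
    iota 0 k.+1 ++ iota k.+1 j.+1 ++ iota (j.+1 + k.+1) (n - (j.+1 + k.+1)).
  by rewrite [j.+1 + _]addnC -iotaD -(iotaD 0) addnA subnKC // addnC ltnW.
rewrite !pmap_cat.
rewrite -[rev _]/([:: c] ++ [:: b] ++ [:: a]).
have sub1 x i m l : m <= i < m + l -> ancestor p c i = Some x ->
    subseq [:: x] (pmap (ancestor p c) (iota m l)).
  by move=> il ei; rewrite sub1seq mem_pmap -ei map_f // mem_iota.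
apply: cat_subseq; first exact: (sub1 c 0).
apply: cat_subseq; first by apply: sub1 ek; rewrite leqnn addnS ltnS leq_addr.
by apply: sub1 e; rewrite leqnn subnKC // ltnW.
Qed.

(** * Renaming the vertices of a forest *)

Definition relabel s p : parent_map n := [ffun v => omap s (p ((s^-1)%g v))].

Lemma relabelK s : cancel (relabel s) (relabel s^-1).
Proof.
by move=> p; apply/ffunP => v; rewrite !ffunE invgK permK; case: (p v) => //= w; rewrite permK.
Qed.

Lemma ancestor_relabel s p v k :
  ancestor (relabel s p) (s v) k = omap s (ancestor p v k).
Proof.
elim: k => // k; rewrite /ancestor /= => ->.
by case: (iter _ _ _) => //= w; rewrite ffunE permK.
Qed.

Lemma is_forest_relabel s p : is_forest (relabel s p) = is_forest p.
Proof.
apply/forallP/forallP => h v.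
  by have := h (s v); rewrite ancestor_relabel; case: ancestor.
by rewrite -(permKV s v) ancestor_relabel (eqP (h _)).
Qed.

Lemma root_path_relabel s p v :
  root_path (relabel s p) (s v) = map s (root_path p v).
Proof.
rewrite /root_path map_rev; congr rev.
by elim: (iota 0 n) => //= k l IH; rewrite ancestor_relabel IH; case: ancestor.
Qed.

Lemma order_isomorphic321 (a b c : 'I_n) :
  order_isomorphic [tuple a; b; c] pattern321 = (c < b < a).
Proof.
pose i0 : 'I_3 := ord0; pose i1 : 'I_3 := lift ord0 ord0; pose i2 : 'I_3 := ord_max.
apply/'forall_forallP/idP => [h|/andP[cb ba] i j].
  have := h i2 i1; have := h i1 i0; rewrite !(tnth_nth a) !permE /= => /eqP-> /eqP->.
  by [].
have ca := ltn_trans cb ba.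
rewrite !permE !(tnth_nth a).
case: i => [[|[|[|//]]]] /= _; case: j => [[|[|[|//]]]] /= _;
  by rewrite ?ltnn ?cb ?ba ?ca // ltnNge ltnW.
Qed.

Lemma order_isomorphic312 (a b c : 'I_n) :
  order_isomorphic [tuple a; b; c] pattern312 = (b < c < a).
Proof.
pose i0 : 'I_3 := ord0; pose i1 : 'I_3 := lift ord0 ord0; pose i2 : 'I_3 := ord_max.
apply/'forall_forallP/idP => [h|/andP[cb ba] i j].
  have := h i1 i2; have := h i2 i0; rewrite !(tnth_nth a) !permE /= => /eqP-> /eqP->.
  by [].
have ca := ltn_trans cb ba.
rewrite !permE !(tnth_nth a).
case: i => [[|[|[|//]]]] /= _; case: j => [[|[|[|//]]]] /= _;
  by rewrite ?ltnn ?cb ?ba ?ca // ltnNge ltnW.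
Qed.

(** Root paths of the renamed forest are images under [s] of those of [p], so ancestry stays fixed
    and [s] becomes a labeling. *)
Lemma avoids_relabelP (q : 'S_3) s p : is_forest p ->
  reflect (forall a b c, proper_ancestor p a b -> proper_ancestor p b c ->
             ~~ order_isomorphic [tuple s a; s b; s c] q)
          (avoids (relabel s p) q).
Proof.
move=> pF; apply: (iffP forallP) => [h a b c ab bc|h v].
  apply: contra (h (s c)) => iso; apply/existsP; exists [tuple s a; s b; s c].
  rewrite iso andbT root_path_relabel.
  by have := map_subseq s (root_path_subseq pF ab bc).
apply/existsP => -[t /andP[]].
rewrite -(permKV s v) root_path_relabel => /(map_subseq (s^-1)%g).
rewrite mapK; last exact: permK.
case: t => [[|x [|y [|z [|]]]] tS] //=.
move=> /(subseq_root_path pF)[xy yz]; apply/negP.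
have := h _ _ _ xy yz; rewrite !permKV; congr (~~ order_isomorphic _ _).
exact: val_inj.
Qed.

Lemma avoids321_relabel s p : is_forest p ->
  avoids (relabel s p) pattern321 = [forall u, mid321_free (proper_ancestor p) s u].
Proof.
move=> pF; apply/(avoids_relabelP _ _ pF)/forallP => h.
  move=> u; apply/mid321_freeP => w v wu uv a b.
  by have := h _ _ _ wu uv; rewrite order_isomorphic321 a b.
move=> a b c ab bc; rewrite order_isomorphic321; apply/negP => /andP[x y].
by have /mid321_freeP := h b; apply; eauto.
Qed.

Lemma avoids312_relabel s p : is_forest p ->
  avoids (relabel s p) pattern312 = [forall u, low312_free (proper_ancestor p) s u].
Proof.
move=> pF; apply/(avoids_relabelP _ _ pF)/forallP => h.
  move=> u; apply/low312_freeP => w v wu uv a b.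
  by have := h _ _ _ wu uv; rewrite order_isomorphic312 a b.
move=> a b c ab bc; rewrite order_isomorphic312; apply/negP => /andP[x y].
by have /low312_freeP := h b; apply; eauto.
Qed.

(** Double counting: for each fixed [s], [relabel s] permutes the forests, so every [s] contributes
    the same number. *)
Lemma fact_num_avoiding_forests (q : 'S_3) :
  n`! * num_avoiding_forests n q
  = \sum_(p | is_forest p) #|[set s | avoids (relabel s p) q]|.
Proof.
rewrite -card_Sn -sum_nat_const.
transitivity (\sum_(s in 'S_n) \sum_(p | is_forest p) avoids (relabel s p) q); last first.
  rewrite exchange_big /=; apply: eq_bigr => p _.
  rewrite -sum1dep_card [RHS]big_mkcond /=. by apply: eq_big.
apply: eq_bigr => s _; rewrite /num_avoiding_forests -sum1dep_card.
rewrite (reindex_inj (can_inj (relabelK s))) big_mkcondr /=.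
by apply: eq_bigl => p; rewrite is_forest_relabel.
Qed.

End Ancestry.

Theorem theorem3p2 :
  (forall n : nat, 1 <= n ->
     num_avoiding_forests n pattern321 = num_avoiding_forests n pattern312) /\
  forest_Wilf_equivalent pattern321 pattern312.
Proof.
suff H : forest_Wilf_equivalent pattern321 pattern312 by split=> // n _; apply: H.
move=> n; apply/eqP; rewrite -(eqn_pmul2l (fact_gt0 n)) !fact_num_avoiding_forests.
apply/eqP; apply: eq_bigr => p pF.
transitivity #|[set s | [forall u, mid321_free (proper_ancestor p) s u]]|.
  by apply: eq_card => s; rewrite !inE avoids321_relabel.
rewrite card_labelings; last 3 first.
- exact: proper_ancestor_irr.
- exact: proper_ancestor_trans.
- by move=> *; apply: proper_ancestor_chain; eauto.
by apply: eq_card => s; rewrite !inE avoids312_relabel.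
Qed.
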